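(* Let $(R,\mathfrak m)$ be a local Cohen-Macaulay ring with infinite residue field, $I$ an $\mathfrak m$-primary $R$-ideal, and $L$ and $H$ two $R$-ideals such that $LH=0$ in $R$. Write $e=e(I;R/H)$ for the multiplicity of the ring $R/H$ with respect to the ideal $I$. Then $L I^{e}\subset\mathrm{core}(I)$.
   Context: The core of an ideal $I$ in a Noetherian ring, $\mathrm{core}(I)$, is the intersection of all reductions of $I$ (ideals $K\subset I$ with $I^{r+1}=KI^r$ for some $r\ge0$). $e(I;R/H)$ is the Hilbert-Samuel multiplicity of the ring $R/H$ with respect to the image of $I$ (computed with respect to the dimension of $R/H$). A power of an ideal with non-positive exponent is the unit ideal. *)

(* Defs.v *)
From HB Require Import structures.
From mathcomp Require Import all_boot all_order all_algebra.
From mathcomp Require Import boolp classical_sets functions cardinality.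

Set Implicit Arguments.
Unset Strict Implicit.
Unset Printing Implicit Defensive.

Import Order.TTheory GRing.Theory.
Local Open Scope classical_set_scope.
Local Open Scope ring_scope.

(* So that a set, and below an ideal, applies to its elements. *)
Identity Coercion fun_of_set : set >-> Funclass.

(* Not necessarily proper, unlike MathComp's [idealr]. *)
Definition is_ideal (R : comPzRingType) (J : set R) : Prop :=
  [/\ J 0, (forall x y, J x -> J y -> J (x + y))
    & forall a x, J x -> J (a * x)].

Record ideal (R : comPzRingType) := Ideal {
  ideal_set :> set R;
  idealP : is_ideal ideal_set
}.

Section IdealOperations.
Variable R : comPzRingType.
Implicit Types (I J K : ideal R) (A : set R).

Lemma is_ideal_setT : is_ideal [set: R].
Proof. by []. Qed.

Definition idealT : ideal R := Ideal is_ideal_setT.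

Lemma is_ideal_gen A : is_ideal [set x | forall J, A `<=` J -> J x].
Proof.
split=> [J _|x y Jx Jy J AJ|a x Jx J AJ]; case: (idealP J) => J0 JD JM //.
- by apply: JD; [apply: Jx|apply: Jy].
- by apply: JM; apply: Jx.
Qed.

Definition ideal_gen A : ideal R := Ideal (is_ideal_gen A).

Definition ideal_mul I J : ideal R :=
  ideal_gen [set x * y | x in (I : set R) & y in (J : set R)].

Definition ideal_exp I (n : nat) : ideal R := iter n (ideal_mul I) idealT.

Definition proper I : Prop := ~ I 1.

Definition prime_ideal I : Prop :=
  proper I /\ forall x y, I (x * y) -> I x \/ I y.

Definition maximal_ideal I : Prop :=
  proper I /\ forall J, proper J -> I `<=` J -> J = I :> set R.

Definition radical I : set R := [set x | exists n, I (x ^+ n)].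

Definition primary_ideal I : Prop :=
  proper I /\ forall x y, I (x * y) -> I x \/ radical I y.

(* I is P-primary *)
Definition primary_to (P I : ideal R) : Prop :=
  primary_ideal I /\ radical I = P.

Definition reduction (K I : ideal R) : Prop :=
  K `<=` I /\
  exists r, ideal_exp I r.+1 = ideal_mul K (ideal_exp I r) :> set R.

Definition core I : set R := \bigcap_(K in [set K | reduction K I]) K.

End IdealOperations.

Section Quotient.
Variables (R : comPzRingType) (J : ideal R).

Definition ideal_mem : {pred R} := fun x => `[< J x >].

Lemma ideal_mem_zmod_closed : zmod_closed ideal_mem.
Proof.
case: (idealP J) => J0 JD JM; split=> [|x y /asboolP Jx /asboolP Jy].
  exact/asboolP.
by apply/asboolP; apply: JD => //; rewrite -mulN1r; apply: JM.
Qed.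

HB.instance Definition _ :=
  GRing.isZmodClosed.Build R ideal_mem ideal_mem_zmod_closed.

(* The ring R/J; it is the zero ring when J = R. *)
Definition ring_quot : Type := Quotient.quot (ideal_mem : zmodClosed R).

HB.instance Definition _ := GRing.Zmodule.on ring_quot.

Definition quot_map (x : R) : ring_quot :=
  \pi_(Quotient.quot (ideal_mem : zmodClosed R))%qT x.

Lemma quot_map_surj (u : ring_quot) : exists x, quot_map x = u.
Proof. by exists (repr u); apply: reprK. Qed.

Lemma quot_map_eq x y : quot_map x = quot_map y <-> J (x - y).
Proof.
have E := Quotient.idealrBE (ideal_mem : zmodClosed R) x y.
split=> [/eqP h|Jxy]; first by apply/asboolP; apply: etrans E h.
by apply/eqP; apply: etrans (esym E) _; apply/asboolP.
Qed.

Lemma quot_map_zmod_morphism : zmod_morphism quot_map.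
Proof.
exact: (@pi_is_zmod_morphism _ _ _ (Quotient.quot (ideal_mem : zmodClosed R))).
Qed.

HB.instance Definition _ :=
  GRing.isZmodMorphism.Build R ring_quot quot_map quot_map_zmod_morphism.

Definition quot_one : ring_quot := quot_map 1.

Definition quot_mul (u v : ring_quot) : ring_quot :=
  quot_map (repr u * repr v).

Lemma quot_mapM x y : quot_map (x * y) = quot_mul (quot_map x) (quot_map y).
Proof.
case: (idealP J) => J0 JD JM; apply/quot_map_eq.
have Jr z : J (z - repr (quot_map z)).
  by apply/quot_map_eq; rewrite [RHS]reprK.
set a := repr _; set b := repr _.
have -> : x * y - a * b = y * (x - a) + a * (y - b).
  by rewrite !mulrBr addrA [y * x]mulrC [a * y]mulrC subrK.
by apply: JD; apply: JM; apply: Jr.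
Qed.

Lemma quot_mulA : associative quot_mul.
Proof.
move=> u v w; have [x <-] := quot_map_surj u; have [y <-] := quot_map_surj v.
by have [z <-] := quot_map_surj w; rewrite -!quot_mapM mulrA.
Qed.

Lemma quot_mulC : commutative quot_mul.
Proof. by move=> u v; rewrite /quot_mul mulrC. Qed.

Lemma quot_mul1 : left_id quot_one quot_mul.
Proof.
by move=> u; have [x <-] := quot_map_surj u; rewrite -quot_mapM mul1r.
Qed.

Lemma quot_mulDl : left_distributive quot_mul +%R.
Proof.
move=> u v w; have [x <-] := quot_map_surj u; have [y <-] := quot_map_surj v.
by have [z <-] := quot_map_surj w; rewrite -raddfD -!quot_mapM -raddfD mulrDl.
Qed.

HB.instance Definition _ := GRing.Zmodule_isComPzRing.Build ring_quot
  quot_mulA quot_mulC quot_mul1 quot_mulDl.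

HB.instance Definition _ := GRing.isMonoidMorphism.Build R ring_quot quot_map
  (conj (erefl : quot_map 1 = 1) quot_mapM).

(* The image of the ideal I in R/J. *)
Definition quot_ideal (I : ideal R) : ideal ring_quot :=
  ideal_gen (quot_map @` I).

End Quotient.

Section Invariants.
Variable R : comPzRingType.
Implicit Types (m I J : ideal R).

Definition noetherian : Prop :=
  forall J, exists s : seq R, J = ideal_gen [set` s] :> set R.

(* m is the unique maximal ideal of R. *)
Definition local_ring m : Prop :=
  maximal_ideal m /\
  forall m' : ideal R, maximal_ideal m' -> m' = m :> set R.

(* The lengths n of the chains K_0 < K_1 < ... < K_n of ideals satisfying C. *)
Definition chain_lengths (C : set (ideal R)) : set nat :=
  [set n | exists K : nat -> ideal R,
    (forall i, (i <= n)%N -> C (K i)) /\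
    (forall i, (i < n)%N -> K i `<` K i.+1)].

(* d = dim R. The supremum is taken in nat, so the zero ring gets d = 0. *)
Definition krull_dim (d : nat) : Prop :=
  supremums (chain_lengths (@prime_ideal R)) d.

(* l is the length of the R-module R/J, whose submodules are the K/J for K
   an ideal containing J. *)
Definition quot_length J (l : nat) : Prop :=
  supremums (chain_lengths [set K | J `<=` K]) l.

Definition regular_seq (s : seq R) : Prop :=
  proper (ideal_gen [set` s]) /\
  forall i, (i < size s)%N -> forall y,
    ideal_gen [set` take i s] (s`_i * y) -> ideal_gen [set` take i s] y.

(* t is the depth of the local ring (R, m). *)
Definition depth m (t : nat) : Prop :=
  supremums [set size s | s in [set s | regular_seq s /\ [set` s] `<=` m]] t.

Definition local_cohen_macaulay m : Prop :=
  [/\ noetherian, local_ring m & exists2 d, krull_dim d & depth m d].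

(* e = e(I; R): for n large, the length of R/I^n is P(n) for a polynomial
   P(n) = (e / d!) n^d + (terms of lower degree), where d = dim R. *)
Definition multiplicity I (e : nat) : Prop :=
  exists (d : nat) (P : {poly rat}),
    [/\ krull_dim d,
        exists N, forall n, (N <= n)%N ->
          exists2 l, quot_length (ideal_exp I n) l & P.[n%:R] = l%:R,
        (size P <= d.+1)%N
      & e%:R = d`!%:R * P`_d].

End Invariants.

Arguments noetherian : clear implicits.
Arguments krull_dim : clear implicits.

(* Main.v *)
Require Import Defs.
From mathcomp Require Import all_boot all_order all_algebra.
From mathcomp Require Import boolp classical_sets functions cardinality.
From mathcomp Require Import ring lra zify.

(** Let K be a reduction of I and d = dim R = depth R. The idea is to find an
    ideal J = (x_1, ..., x_d) inside K which is generated by an R-regular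
    sequence and is a reduction of I modulo H, in the sense that I^(n+r) lies in
    J^n + H for all n, and then to compare lengths modulo the ideals J^n : L.

    Since L H = 0, the ideal J^n : L contains J^n + H, hence I^(n+r) + H, so
    R/(J^n : L) has length at most P(n+r), where P is the Hilbert polynomial of I
    on R/H; its growth is at most (e / d!) n^d. On the other hand the powers of
    an ideal generated by a regular sequence satisfy J^n : x_1 = J^(n-1), which
    gives, by induction on d and n,
      length R/(J^n : L) >= length R/(J : L) * binomial(n + d - 1, d)
    (lemma regular_power_chain). Comparing leading terms (hilbert_bound), the
    length of R/(J : L) is at most e. If I^e were not contained in J : L, then by
    Nakayama the ideals (J : L) + I^i for i = 0, ..., e, followed by J : L itself,
    would form a strict chain with e + 1 steps. Hence L I^e lies in J, so in K.

    The sequence x is found in two steps.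

    - A reduction modulo H with d generators (exists_reduction, from
      drop_generator). If z, x_1, ..., x_k generate J and every linear change
      x_i - c_i z fails to generate a reduction of J modulo H, then all the
      points (c : 1) lie on the projective scheme of the fibre ring of J on R/H. The
      points being taken in an infinite grid, the fibre ring is as large as a polynomial ring in
      k + 1 variables (fiber_chain), so that the growth of lengths forces
      k + 1 <= d.

    - These d generators are then changed into a regular sequence, by adding to
      each one a combination of the following ones and of elements of both H and K
      (exists_regular_on); this does not change J + H. It is possible because the
      depth drops by at most one modulo a nonzerodivisor in m (depth_adj), and
      because an element in general position in a coset w + (b_1, ..., b_n) is a
      nonzerodivisor as soon as w, b_1, ..., b_n have no common annihilator
      (coset_nzd). No primary decomposition is involved: for scalars c with
      invertible differences the annihilators of the elements w + c b behave like
      eigenspaces, their sum is direct, and a Noetherian module leaves room for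
      finitely many of them only. *)

Set Implicit Arguments.
Unset Strict Implicit.
Unset Printing Implicit Defensive.

Import Order.TTheory GRing.Theory Num.Theory.
Local Open Scope classical_set_scope.
Local Open Scope ring_scope.

(** * Arithmetic of ideals *)

Section IdealArithmetic.
Variable R : comPzRingType.
Implicit Types (A B C E J L X : ideal R) (x y z u v : R) (xs : seq R).

Lemma ideal0 A : A 0. Proof. by case: (idealP A). Qed.

Lemma idealD A x y : A x -> A y -> A (x + y).
Proof. by case: (idealP A) => _ + _; apply. Qed.

Lemma idealM A a x : A x -> A (a * x).
Proof. by case: (idealP A) => _ _; apply. Qed.

Lemma idealMr A a x : A x -> A (x * a).
Proof. by rewrite mulrC; apply: idealM. Qed.

Lemma idealN A x : A x -> A (- x).
Proof. by rewrite -mulN1r; apply: idealM. Qed.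

Lemma idealB A x y : A x -> A y -> A (x - y).
Proof. by move=> Ax Ay; apply: idealD => //; apply: idealN. Qed.

Lemma ideal_sum A n (f : nat -> R) :
  (forall i, (i < n)%N -> A (f i)) -> A (\sum_(i < n) f i).
Proof.
move=> Af; elim/big_ind: _ => [|x y|[i lti] _]; [exact: ideal0|exact: idealD|].
exact: Af.
Qed.

Lemma ideal_one A x : A 1 -> A x.
Proof. by move=> /(idealM x); rewrite mulr1. Qed.

Lemma ideal_ext A B : A `<=` B -> B `<=` A -> A = B.
Proof.
case: A => A pA; case: B => B pB /= AB BA.
have eqAB : A = B by apply/seteqP.
by subst B; congr Ideal; apply: Prop_irrelevance.
Qed.

Lemma is_ideal_zero : is_ideal [set 0 : R].
Proof.
by split=> [//|x y -> ->|a x ->]; rewrite /= ?addr0 ?mulr0.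
Qed.

Definition zero_ideal : ideal R := Ideal is_ideal_zero.

Lemma is_ideal_add A B : is_ideal [set x + y | x in (A : set R) & y in (B : set R)].
Proof.
split=> [|_ _ [a Aa [b Bb <-]] [a' Aa' [b' Bb' <-]]|c _ [a Aa [b Bb <-]]].
- by exists 0; [apply: ideal0|exists 0; [apply: ideal0|rewrite addr0]].
- exists (a + a'); [exact: idealD|exists (b + b'); [exact: idealD|ring]].
- exists (c * a); [exact: idealM|exists (c * b); [exact: idealM|ring]].
Qed.

Definition ideal_add A B : ideal R := Ideal (is_ideal_add A B).

Lemma is_ideal_scale x A : is_ideal [set x * a | a in (A : set R)].
Proof.
split=> [|_ _ [a Aa <-] [b Ab <-]|c _ [a Aa <-]].
- by exists 0; [apply: ideal0|rewrite mulr0].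
- by exists (a + b); [apply: idealD|rewrite mulrDr].
- by exists (c * a); [apply: idealM|rewrite mulrCA].
Qed.

Definition ideal_scale x A : ideal R := Ideal (is_ideal_scale x A).

Lemma is_ideal_colon E L : is_ideal [set u | forall l, L l -> E (l * u)].
Proof.
split=> [l _|x y Ex Ey l Ll|a x Ex l Ll] /=.
- by rewrite mulr0; apply: ideal0.
- by rewrite mulrDr; apply: idealD; [apply: Ex|apply: Ey].
- by rewrite mulrCA; apply: idealM; apply: Ex.
Qed.

Definition colon E L : ideal R := Ideal (is_ideal_colon E L).

Lemma is_ideal_colon1 E x : is_ideal [set u | E (x * u)].
Proof.
split=> [|u v Eu Ev|a u Eu] /=; first by rewrite mulr0; apply: ideal0.
  by rewrite mulrDr; apply: idealD.
by rewrite mulrCA; apply: idealM.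
Qed.

Definition colon1 E x : ideal R := Ideal (is_ideal_colon1 E x).

Lemma colon1E E x u : colon1 E x u = E (x * u). Proof. by []. Qed.

Definition adj A x : ideal R := ideal_add A (ideal_scale x (idealT R)).

Definition gens xs : ideal R := foldr (fun x A => adj A x) zero_ideal xs.

Lemma ideal_addL A B : A `<=` ideal_add A B.
Proof. by move=> x Ax; exists x => //; exists 0; [apply: ideal0|rewrite addr0]. Qed.

Lemma ideal_addR A B : B `<=` ideal_add A B.
Proof. by move=> x Bx; exists 0; [apply: ideal0|exists x => //; rewrite add0r]. Qed.

Lemma ideal_add_sub A B C : A `<=` C -> B `<=` C -> ideal_add A B `<=` C.
Proof. by move=> sAC sBC _ [x Ax [y By <-]]; apply: idealD; [apply: sAC|apply: sBC]. Qed.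

Lemma ideal_addS A A' B B' :
  A `<=` A' -> B `<=` B' -> ideal_add A B `<=` ideal_add A' B'.
Proof.
by move=> AA BB _ [x Ax [y By <-]]; exists x; [apply: AA|exists y => //; apply: BB].
Qed.

Lemma adjl A x : A `<=` adj A x. Proof. exact: ideal_addL. Qed.

Lemma adj_mem A x : adj A x x.
Proof. by apply: ideal_addR; exists 1 => //; rewrite mulr1. Qed.

Lemma adj_sub A x C : A `<=` C -> C x -> adj A x `<=` C.
Proof.
by move=> sAC Cx; apply: ideal_add_sub => // _ [a _ <-]; apply: idealMr.
Qed.

Lemma adjP A x u : adj A x u <-> exists t, A (u - x * t).
Proof.
split=> [[y Ay [_ [t _ <-] <-]]|[t At]]; first by exists t; rewrite ?addrK.
by exists (u - x * t) => //; exists (x * t); [exists t|rewrite subrK].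
Qed.

Lemma adjC A x y : adj (adj A x) y = adj (adj A y) x.
Proof.
by apply: ideal_ext; (apply: adj_sub; first apply: adj_sub);
  do ?[exact: adj_mem | apply: adjl | move=> ? ?].
Qed.

Lemma ideal_add_adj A B x : ideal_add A (adj B x) = ideal_add (adj A x) B.
Proof.
apply: ideal_ext; apply: ideal_add_sub.
- by move=> u Au; apply: ideal_addL; apply: adjl.
- apply: adj_sub; first exact: ideal_addR.
  by apply: ideal_addL; apply: adj_mem.
- apply: adj_sub; first exact: ideal_addL.
  by apply: ideal_addR; apply: adj_mem.
- by move=> u Bu; apply: ideal_addR; apply: adjl.
Qed.

Lemma ideal_add0 A : ideal_add A zero_ideal = A.
Proof.
apply: ideal_ext; last exact: ideal_addL.
by apply: ideal_add_sub => // _ ->; apply: ideal0.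
Qed.

Lemma gens_mem xs x : x \in xs -> gens xs x.
Proof.
elim: xs => //= y xs IHxs; rewrite inE => /orP[/eqP->|/IHxs gx]; first exact: adj_mem.
exact: adjl.
Qed.

Lemma gens_sub xs A : (forall x, x \in xs -> A x) -> gens xs `<=` A.
Proof.
elim: xs => [_ _ ->|y xs IHxs /= Axs]; first exact: ideal0.
apply: adj_sub; last by apply: Axs; rewrite mem_head.
by apply: IHxs => x xs_x; apply: Axs; rewrite inE xs_x orbT.
Qed.

Lemma gens_rcons xs x : gens (rcons xs x) = adj (gens xs) x.
Proof. by elim: xs => //= y xs ->; rewrite adjC. Qed.

Lemma ideal_gen_seq xs : ideal_gen [set` xs] = gens xs.
Proof.
apply: ideal_ext => [x|]; first by apply => y /= /gens_mem.
by apply: gens_sub => x xs_x J; apply.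
Qed.

Lemma ideal_mul_mem A B x y : A x -> B y -> ideal_mul A B (x * y).
Proof. by move=> Ax By J; apply; exists x => //; exists y. Qed.

Lemma ideal_mul_sub A B C :
  (forall x y, A x -> B y -> C (x * y)) -> ideal_mul A B `<=` C.
Proof. by move=> ABC x; apply=> _ [a Aa [b Bb <-]]; apply: ABC. Qed.

Lemma ideal_mulS A A' B B' :
  A `<=` A' -> B `<=` B' -> ideal_mul A B `<=` ideal_mul A' B'.
Proof.
move=> AA BB; apply: ideal_mul_sub => x y Ax By.
by apply: ideal_mul_mem; [apply: AA|apply: BB].
Qed.

Lemma ideal_mulr A B : ideal_mul A B `<=` B.
Proof. by apply: ideal_mul_sub => x y _; apply: idealM. Qed.

Lemma ideal_mull A B : ideal_mul A B `<=` A.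
Proof. by apply: ideal_mul_sub => x y Ax _; apply: idealMr. Qed.

Lemma exp_sub A B n : A `<=` B -> ideal_exp A n `<=` ideal_exp B n.
Proof. by move=> AB; elim: n => //= n IHn; apply: ideal_mulS. Qed.

Lemma exp_mem A x n : A x -> ideal_exp A n (x ^+ n).
Proof. by move=> Ax; elim: n => //= n IHn; rewrite exprS; apply: ideal_mul_mem. Qed.

Lemma exp_le A k n : (k <= n)%N -> ideal_exp A n `<=` ideal_exp A k.
Proof.
elim: n => [|n IHn]; first by rewrite leqn0 => /eqP->.
rewrite leq_eqVlt => /orP[/eqP->//|ltkn]; apply: subset_trans (IHn ltkn).
exact: ideal_mulr.
Qed.

Lemma exp1_sub A n : (0 < n)%N -> ideal_exp A n `<=` A.
Proof. by case: n => // n _; apply: ideal_mull. Qed.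

Lemma exp1 A : ideal_exp A 1 = A.
Proof.
apply: ideal_ext; first exact: exp1_sub.
by move=> x Ax; rewrite -[x]mulr1; apply: ideal_mul_mem.
Qed.

Lemma exp_add_sub A C a b :
  (forall x y, ideal_exp A a x -> ideal_exp A b y -> C (x * y)) ->
  ideal_exp A (a + b) `<=` C.
Proof.
elim: a C => [C Cxy x Ax|a IHa C Cxy]; first by rewrite -[x]mul1r; apply: Cxy.
apply: ideal_mul_sub => x y Ax; suff : ideal_exp A (a + b) `<=` colon1 C x by apply.
apply: IHa => u v Au Av /=; rewrite mulrA; apply: Cxy => //.
exact: ideal_mul_mem.
Qed.

Lemma exp_addS A n x y : A x -> ideal_exp A n y -> ideal_exp A n.+1 (x * y).
Proof. exact: ideal_mul_mem. Qed.

Lemma exp_mul A a b x y :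
  ideal_exp A a x -> ideal_exp A b y -> ideal_exp A (a + b) (x * y).
Proof.
elim: a x => [x _|a IHa x Ax Ay]; first exact: idealM.
suff : ideal_exp A a.+1 `<=` colon1 (ideal_exp A (a.+1 + b)) y.
  by move=> /(_ x Ax); rewrite colon1E mulrC.
apply: ideal_mul_sub => c v Ac Av; rewrite colon1E mulrCA.
by apply: exp_addS; rewrite // mulrC; apply: IHa.
Qed.

Lemma exp_exp A B a b :
  ideal_exp A a `<=` B -> ideal_exp A (a * b) `<=` ideal_exp B b.
Proof.
move=> AB; elim: b => [|b IHb]; first by rewrite muln0.
rewrite mulnS; apply: exp_add_sub => x y Ax Ay.
by apply: exp_addS; [apply: AB|apply: IHb].
Qed.

(** In a product of n + 1 factors taken from A + (x), either every factor comes
    from A or one factor x can be pulled out. *)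
Lemma adj_exp A x n :
  ideal_exp (adj A x) n.+1 `<=`
  ideal_add (ideal_exp A n.+1) (ideal_scale x (ideal_exp (adj A x) n)).
Proof.
elim: n => [|n IHn].
  by rewrite !exp1.
apply: ideal_mul_sub => _ v [a Aa [_ [t _ <-] <-]] Jv.
have [b Ab [_ [w Jw <-] eqv]] := IHn v Jv.
rewrite (_ : _ * v = a * b + x * (a * w + t * v)); last by rewrite -eqv; ring.
apply: idealD.
  by apply: ideal_addL; apply: exp_addS.
apply: ideal_addR; exists (a * w + t * v) => //.
apply: idealD; last exact: idealM.
by apply: exp_addS => //; apply: adjl.
Qed.

Lemma adj_exp_iter A x p q :
  ideal_exp (adj A x) (p + q) `<=` adj (ideal_exp A p) (x ^+ q).
Proof.
elim: q => [u _|q IHq u].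
  by apply: ideal_addR; exists u => //; rewrite expr0 mul1r.
rewrite addnS => /adj_exp[y Ay [_ [v Jv <-] <-]].
apply: idealD; first by apply: adjl; apply: exp_le Ay; rewrite -addnS leq_addr.
have /adjP[t At] := IHq v Jv; apply/adjP; exists t.
by rewrite exprS -mulrA -mulrBr; apply: idealM.
Qed.

(** Over a Noetherian ring this turns a statement about the radical of an ideal
    into the inclusion of a power of the maximal ideal. *)
Lemma gens_nilpotent xs A :
  (forall x, x \in xs -> exists n, A (x ^+ n)) -> exists p, ideal_exp (gens xs) p `<=` A.
Proof.
elim: xs => [_|x xs IHxs nilxs].
  by exists 1%N; rewrite exp1; apply: gens_sub.
have [|p expA] := IHxs; first by move=> y xs_y; apply: nilxs; rewrite inE xs_y orbT.
have [q Axq] := nilxs x (mem_head _ _).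
exists (p + q)%N => u /adj_exp_iter; exact: adj_sub.
Qed.

End IdealArithmetic.

(* Otherwise simplification replaces every ideal by the set it stands for. *)
Arguments ideal_set : simpl never.
Arguments ideal_exp : simpl never.
(** * Noetherian local rings *)

Section NoetherianLocal.
Variables (R : comPzRingType) (m : ideal R).
Hypotheses (noethR : noetherian R) (locR : local_ring m).
Implicit Types (A B C E H I J K L M N X : ideal R) (w x y z u v : R) (xs bs : seq R).

Lemma noetherian_gens A : exists xs, A = gens xs.
Proof.
have [xs defA] := noethR A; exists xs.
by rewrite -ideal_gen_seq; apply: ideal_ext; rewrite defA.
Qed.

Lemma exists_maximal A : ~ A 1 -> exists2 M, maximal_ideal M & A `<=` M.
Proof.
move=> A1.
(* Adding A to S makes the empty chain bounded by A itself. *)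
pose P (S : set R) := is_ideal (S `|` A) /\ ~ (S `|` A) 1.
have [F FP totF|S [[idS S1] maxS]] := @Zorn_bigcup R P.
  split; last by move=> [[S /FP[_ S1] S_1]|//]; apply: S1; left.
  have inS S x : F S -> (S `|` A) x -> (\bigcup_(X in F) X `|` A) x.
    by move=> FS [Sx|]; [left; exists S|right].
  split=> [|x y|a x [[S FS Sx]|Ax]].
  - by right; apply: ideal0.
  - move=> [[S FS Sx]|Ax] [[S' FS' Sy]|Ay].
    + have [sSS'|sS'S] := totF S S' FS FS'.
        apply: (inS S') => //; have [[_ + _] _] := FP _ FS'.
        by apply; left => //; apply: sSS'.
      apply: (inS S) => //; have [[_ + _] _] := FP _ FS.
      by apply; left => //; apply: sS'S.
    + by apply: (inS S) => //; have [[_ + _] _] := FP _ FS; apply; [left|right].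
    + by apply: (inS S') => //; have [[_ + _] _] := FP _ FS'; apply; [right|left].
    + by right; apply: idealD.
  - by apply: (inS S) => //; have [[_ _ +] _] := FP _ FS; apply; left.
  - by right; apply: idealM.
exists (Ideal idS) => [|x Ax]; last by right.
split=> // J J1 sSJ; apply/seteqP; split=> // x Jx.
apply: contrapT => nSx; apply: (maxS J); last first.
  rewrite /P (_ : J `|` A = J); first by split; [apply: idealP|].
  by apply/seteqP; split=> [y [//|Ay]|y]; [apply: sSJ; right|left].
by split=> [y Sy|sJS]; [apply: sSJ; left|apply: nSx; left; apply: sJS].
Qed.

Lemma local_proper : ~ m 1. Proof. by case: locR => -[]. Qed.

(** A non-unit generates a proper ideal, and a maximal ideal above it is m. *)
Lemma local_unit x : ~ m x -> exists y, y * x = 1.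
Proof.
move=> nmx; apply: contrapT => nunit.
have [|M maxM xM] := @exists_maximal (adj (zero_ideal R) x).
  by move=> /adjP[t /= /eqP]; rewrite subr_eq0 mulrC => /eqP xt1; apply: nunit; exists t.
by case: locR => _ /(_ M maxM) defM; apply: nmx; rewrite -defM; apply: xM; apply: adj_mem.
Qed.

Lemma proper_sub_max A : ~ A 1 -> A `<=` m.
Proof.
move=> A1 x Ax; apply: contrapT => /local_unit[y yx]; apply: A1.
by rewrite -yx; apply: idealM.
Qed.

(** Induction on the number of generators of N: modulo M, the first generator is a
    combination of the others because 1 - a is invertible for a in m. *)
Lemma nakayama N M : N `<=` ideal_add M (ideal_mul m N) -> N `<=` M.
Proof.
have [xs ->] := noetherian_gens N.
elim: xs => [_ _ ->|x xs IHxs /= sub]; first exact: ideal0.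
set A := gens xs in IHxs sub *.
have mul_adj : ideal_mul m (adj A x) `<=` ideal_add (ideal_mul m A) (ideal_scale x m).
  apply: ideal_mul_sub => a _ ma [y Ay [_ [t _ <-] <-]]; exists (a * y).
    exact: ideal_mul_mem.
  by exists (x * (t * a)); [exists (t * a) => //; apply: idealM|ring].
have MAx : ideal_add M (ideal_mul m A) x.
  have [y My [_ /mul_adj[z Az [_ [a ma <-] <-]] eqx]] := sub x (adj_mem _ _).
  have [b b1] : exists b, b * (1 - a) = 1.
    apply: local_unit => m1; apply: local_proper.
    by rewrite -(subrK a 1); apply: idealD.
  exists (b * y); first exact: idealM.
  exists (b * z); first exact: idealM.
  rewrite -[RHS]mul1r -b1 -mulrDr -mulrA; congr (b * _).
  by rewrite mulrBl mul1r -{1}eqx; ring.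
have sAM : A `<=` M.
  apply: IHxs => v Av.
  have [y My [_ /mul_adj[z Az [_ [a ma <-] <-]] <-]] := sub v (adjl x Av).
  rewrite addrA; apply: idealD; last exact: idealMr.
  by exists y => //; exists z.
apply: adj_sub => //; apply: ideal_add_sub MAx => //.
exact: subset_trans (@ideal_mulr _ _ _) _.
Qed.

Fixpoint adjs X (u : nat -> R) k : ideal R :=
  if k is k'.+1 then adj (adjs X u k') (u k') else X.

Lemma adjs_le X (u : nat -> R) j k : (j <= k)%N -> adjs X u j `<=` adjs X u k.
Proof.
elim: k => [|k IHk]; first by rewrite leqn0 => /eqP->.
rewrite leq_eqVlt => /orP[/eqP->//|/IHk sub]; apply: subset_trans sub _.
exact: adjl.
Qed.

Lemma adjsP X (u : nat -> R) k v : adjs X u k v ->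
  exists f : nat -> R, X (v - \sum_(i < k) f i * u i).
Proof.
elim: k v => [|k IHk] v /=; first by exists (fun=> 0); rewrite big_ord0 subr0.
move=> /adjP[t /IHk[f Xf]]; exists (fun i => if i == k then t else f i).
rewrite big_ord_recr /= eqxx (eq_bigr (fun i : 'I_k => f i * u i)); last first.
  by move=> i _; rewrite ltn_eqF.
by move: Xf; congr (X _); ring.
Qed.

(** The ascending chain condition, in the form in which it bounds the number of
    independent annihilators below. *)
Lemma noetherian_stable X (u : nat -> R) : exists k, forall j, adjs X u k (u j).
Proof.
have idU : is_ideal [set v | exists k, adjs X u k v].
  split=> [|x y [j ux] [k uy]|a x [k ux]]; first by exists 0%N; apply: ideal0.
    exists (maxn j k); apply: idealD; [move: ux|move: uy]; apply: adjs_le.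
      exact: leq_maxl.
    exact: leq_maxr.
  by exists k; apply: idealM.
have [xs /= defU] := noetherian_gens (Ideal idU).
have [k xsk] : exists k, forall x, x \in xs -> adjs X u k x.
  have : forall x, x \in xs -> exists k, adjs X u k x.
    by move=> x /gens_mem; rewrite -defU.
  elim: (xs) => [|x ys IHys xk]; first by exists 0%N.
  have [|k ysk] := IHys; first by move=> y ysy; apply: xk; rewrite inE ysy orbT.
  have [j xj] := xk x (mem_head _ _); exists (maxn j k) => y.
  rewrite inE => /orP[/eqP->|/ysk]; last exact/adjs_le/leq_maxr.
  by apply: adjs_le xj; apply: leq_maxl.
exists k => j; have /gens_sub := xsk; apply.
by rewrite -defU; exists j.+1; apply: adj_mem.
Qed.

(** * Nonzerodivisors in general position *)

(** The element x is a nonzerodivisor on the module R/X. All modules that occur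
    are of the form R/X, so they are represented by the ideal X. *)
Definition nzd X x := forall u, X (x * u) -> X u.

Section GenericScalars.
Variable t : nat -> R.
Hypothesis t_unit : forall i j, i != j -> exists b, b * (t i - t j) = 1.

(** Independence of eigenvectors for distinct eigenvalues: v_i is killed by
    w + t_i b in R/X. Applying w + t_k b to the sum gets rid of v_k and multiplies
    the other terms by (t_k - t_i) b; by induction b, hence also w, kills each v_i
    with i < k, which is therefore 0. *)
Lemma eigen_indep X (Q : set R) w b :
    (forall u, X (w * u) -> X (b * u) -> (forall q, Q q -> X (q * u)) -> X u) ->
  forall k (v : nat -> R),
    (forall i, (i < k)%N -> X ((w + t i * b) * v i) /\ forall q, Q q -> X (q * v i)) ->
  X (\sum_(i < k) v i) -> forall i, (i < k)%N -> X (v i).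
Proof.
move=> sep; elim=> // k IHk v eigv; rewrite big_ord_recr /= => Xsum.
have Xlow i : (i < k)%N -> X (v i).
  move=> ltik; have [Xi Qi] := eigv i (ltnW ltik).
  have Xb : X (b * v i).
    have [c c1] : exists c, c * (t k - t i) = 1 by apply: t_unit; rewrite gtn_eqF.
    rewrite -[b * _]mul1r -c1 -mulrA; apply: idealM.
    move: i ltik {Xi Qi c c1}.
    apply: (IHk (fun i => (t k - t i) * (b * v i))) => [i ltik|].
      have [Xi Qi] := eigv i (ltnW ltik); split=> [|q Qq].
        rewrite (_ : _ * _ = (t k - t i) * b * ((w + t i * b) * v i)); last by ring.
        exact: idealM.
      rewrite (_ : _ * _ = (t k - t i) * b * (q * v i)); last by ring.
      by apply: idealM; apply: Qi.
    rewrite (_ : \sum_(i < k) _ = (w + t k * b) * (\sum_(i < k) v i + v k)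
       - (\sum_(i < k) (w + t i * b) * v i + (w + t k * b) * v k)).
      apply: idealB; first exact: idealM.
      apply: idealD; last by have [] := eigv k (ltnSn k).
      apply: (@ideal_sum _ _ _ (fun i => (w + t i * b) * v i)) => i ltik.
      by have [] := eigv i (ltnW ltik).
    rewrite mulrDr opprD addrACA subrr addr0 mulr_sumr -sumrB.
    by apply: eq_bigr => i _; ring.
  apply: sep => //.
  rewrite (_ : w * _ = (w + t i * b) * v i - t i * (b * v i)); last by ring.
  by apply: idealB => //; apply: idealM.
move=> i; rewrite ltnS leq_eqVlt => /orP[/eqP->|]; last exact: Xlow.
rewrite -(addKr (\sum_(i < k) v i) (v k)); apply: idealD => //; apply: idealN.
exact: ideal_sum.
Qed.

(** Choose for every j, if possible, a nonzero u_j in R/X killed by w + t_j b and by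
    Q. The ideals generated by the u_j become stationary, so every u_j with j large
    is a combination of earlier ones, against independence. *)
Lemma generic_scalars X (Q : set R) w b :
    (forall u, X (w * u) -> X (b * u) -> (forall q, Q q -> X (q * u)) -> X u) ->
  exists n, forall j, (n <= j)%N -> forall u,
    X ((w + t j * b) * u) -> (forall q, Q q -> X (q * u)) -> X u.
Proof.
move=> sep.
(* If there is no nonzero eigenvector, then u_j = 0 serves. *)
pose eig j u := X ((w + t j * b) * u) /\ forall q, Q q -> X (q * u).
have /choice[u u_eig] j : exists u, eig j u /\ (X u -> forall v, eig j v -> X v).
  have [[u [eju nXu]]|noeig] := pselect (exists u, eig j u /\ ~ X u).
    by exists u; split.
  exists 0; split=> [|_ v ejv]; first by split=> [|q _]; rewrite mulr0; apply: ideal0.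
  by apply: contrapT => nXv; apply: noeig; exists v.
have [n stable] := noetherian_stable X u.
exists n => j lenj v Xv Qv; have [eju] := u_eig j; apply => //.
have /adjsP[f Xf] := adjs_le lenj (stable j).
(* The relation expressing u_j by earlier vectors, read as a vanishing sum. *)
pose v' i := if i == j then - u j else f i * u i.
rewrite -[u j]opprK; apply: idealN; rewrite (_ : - u j = v' j); last by rewrite /v' eqxx.
apply: (eigen_indep sep (k := j.+1) (v := v')) => // [i|]; last first.
  rewrite big_ord_recr /= {2}/v' eqxx (eq_bigr (fun i : 'I_j => f i * u i)).
    by rewrite -opprB; apply: idealN.
  by move=> i _; rewrite /v' ltn_eqF.
rewrite ltnS /v' => _; case: eqP => [->|_].
  by case: eju => Xj Qj; split=> [|q /Qj]; rewrite mulrN => *; apply: idealN.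
have [[Xi Qi] _] := u_eig i.
by split=> [|q /Qi ?]; rewrite mulrCA; apply: idealM.
Qed.

(** The elements b of bs are absorbed into w one at a time; Q in the preceding
    lemma holds those still to be absorbed. Finitely many modules can be treated
    together since each of them excludes finitely many scalars. *)
Lemma coset_nzd (T : finType) (X : T -> ideal R) bs w :
    (forall i u, X i (w * u) -> (forall b, b \in bs -> X i (b * u)) -> X i u) ->
  exists2 w', gens bs (w' - w) & forall i, nzd (X i) w'.
Proof.
elim: bs w => [|b bs IHbs] w sep.
  by exists w => [|i u Xwu]; [rewrite subrr|apply: sep].
have /choice[n n_good] i : exists n, forall j, (n <= j)%N -> forall u,
    X i ((w + t j * b) * u) -> (forall q, [set` bs] q -> X i (q * u)) -> X i u.
  apply: generic_scalars => u Xw Xb Xbs; apply: sep => // c.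
  by rewrite inE => /orP[/eqP->|/Xbs].
have [i u Xwu Xbs|w' bw' nzd_w'] := IHbs (w + t (\max_i n i)%N * b).
  exact: (n_good i _ (leq_bigmax i)).
exists w' => //=; apply/adjP; exists (t (\max_i n i)%N).
by rewrite [b * _]mulrC -addrA -opprD.
Qed.


(** * Depth *)

(** Equivalently Hom(R/m, R/X) = 0. *)
Definition socle_free X := forall u, (forall a, m a -> X (a * u)) -> X u.

(** This says that m contains a weakly R/X-regular sequence of length k. *)
Fixpoint depth_ge k X : Prop :=
  if k is k'.+1 then exists z, [/\ m z, nzd X z & depth_ge k' (adj X z)] else True.

Lemma depth_socle_free k X : depth_ge k.+1 X -> socle_free X.
Proof. by move=> [z [mz nzd_z _]] u /(_ z mz); apply: nzd_z. Qed.

(** The easy part of the permutability of regular sequences; the other part,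
    nzd_swapr, needs Nakayama. *)
Lemma nzd_swap X x y : nzd X x -> nzd (adj X x) y -> nzd (adj X y) x.
Proof.
move=> Xx Xxy u /adjP[v Xv].
have /adjP[s Xs] : adj X x v.
  apply: Xxy; apply/adjP; exists u.
  by rewrite -opprB; apply: idealN.
apply/adjP; exists s; apply: Xx.
rewrite (_ : _ * _ = (x * u - y * v) + y * (v - x * s)); last by ring.
by apply: idealD => //; apply: idealM.
Qed.

(** The socles of R/(X, x) and R/(X, z) are both Ext^1(R/m, R/X). Explicitly, for u
    in the first socle the relation z u = x v modulo X defines an element v of the
    second one. *)
Lemma socle_free_exchange X x z : m x -> m z ->
  nzd X x -> nzd X z -> socle_free (adj X z) -> socle_free (adj X x).
Proof.
move=> mx mz Xx Xz soc u mu; have /adjP[v Xv] := mu z mz.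
have /adjP[s Xs] : adj X z v.
  apply: soc => a ma; have /adjP[s Xs] := mu a ma.
  apply/adjP; exists s; apply: Xx.
  rewrite (_ : _ * _ = z * (a * u - x * s) - a * (z * u - x * v)); last by ring.
  by apply: idealB; apply: idealM.
apply/adjP; exists s; apply: Xz.
rewrite (_ : _ * _ = (z * u - x * v) + x * (v - z * s)); last by ring.
by apply: idealD => //; apply: idealM.
Qed.

Lemma socle_free_nzd (T : finType) (X : T -> ideal R) :
  (forall i, socle_free (X i)) -> exists2 w, m w & forall i, nzd (X i) w.
Proof.
move=> socX; have [xs defm] := noetherian_gens m.
have [i u _ Xxs|w mw nzd_w] := coset_nzd (X := X) (bs := xs) (w := 0).
  apply: socX => a; rewrite defm => /(@gens_sub _ xs (colon1 (X i) u)) /=.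
  by rewrite [a * u]mulrC; apply=> x /Xxs; rewrite /= mulrC.
by exists w => //; rewrite defm -[w]subr0.
Qed.

(** The given regular sequence starts with some z rather than with x. Choose w in m
    regular modulo X, (X, x) and (X, z): then x and z may both be exchanged for w,
    which reduces the claim to the smaller depths modulo (X, z) and (X, w). *)
Lemma depth_adj k X x : depth_ge k.+1 X -> m x -> nzd X x -> depth_ge k (adj X x).
Proof.
elim: k X x => // k IHk X x [z [mz Xz depz]] mx Xx.
have socz := depth_socle_free depz.
have socx := socle_free_exchange mx mz Xx Xz socz.
have socX : socle_free X by move=> u /(_ z mz); apply: Xz.
pose Y i := if i is Some b then adj X (if b then x else z) else X.
have [|w mw nzd_w] := socle_free_nzd (X := Y); first by case=> [[]|].
exists w; split=> //; first exact: (nzd_w (Some true)).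
rewrite adjC; apply: (IHk) => //; last exact: nzd_swap (nzd_w (Some true)).
exists z; split=> //; first exact: nzd_swap (nzd_w (Some false)).
by rewrite adjC; apply: IHk => //; apply: (nzd_w (Some false)).
Qed.

Lemma regular_seq_depth s : regular_seq s -> [set` s] `<=` m ->
  depth_ge (size s) (zero_ideal R).
Proof.
move=> [_ reg_s] sm.
suff dep i : (i <= size s)%N -> depth_ge i (gens (take (size s - i) s)).
  by have := dep _ (leqnn _); rewrite subnn take0.
elim: i => // i IHi ltis.
have lt_si : (size s - i.+1 < size s)%N by rewrite ltn_subrL (leq_ltn_trans _ ltis).
exists s`_(size s - i.+1); split; first by apply: sm; apply: mem_nth.
  move=> u; rewrite -ideal_gen_seq; exact: reg_s.
by have := IHi (ltnW ltis); rewrite -gens_rcons -take_nth // -subSn.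
Qed.
Fixpoint regular_on X xs : Prop :=
  if xs is x :: xs' then nzd X x /\ regular_on (adj X x) xs' else True.

Lemma socle_free_exp X p u : socle_free X ->
  (forall a, ideal_exp m p a -> X (a * u)) -> X u.
Proof.
move=> socX; elim: p u => [u /(_ 1)|p IHp u mpu]; first by rewrite mul1r; apply.
apply: IHp => a mpa; apply: socX => b mb; rewrite mulrA.
by apply: mpu; apply: exp_addS.
Qed.

(** At each step the ideal generated by w, by the remaining generators and by B
    contains a power of m modulo X, so it annihilates no nonzero element of R/X, whose socle
    vanishes; then coset_nzd applies. The condition that X, gens ws and B together
    contain a power of m is preserved because w' and w differ by an element of
    (ws) + B. *)
Lemma exists_regular_on X (B K : ideal R) ws p :
    B `<=` K -> K `<=` m -> gens ws `<=` K ->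
    ideal_exp m p `<=` ideal_add (ideal_add X (gens ws)) B ->
    depth_ge (size ws) X ->
  exists xs, [/\ size xs = size ws, gens xs `<=` K, regular_on X xs
    & gens ws `<=` ideal_add (gens xs) B].
Proof.
move=> sBK sKm; elim: ws X => [|w ws IHws] X /= wsK mpX dep.
  exists [::]; split=> //; apply: ideal_addL.
have [bs defB] := noetherian_gens B.
have [_ u Xw Xbs|w' bw' /(_ tt) nzd_w'] :=
    coset_nzd (T := unit) (X := fun=> X) (bs := ws ++ bs) (w := w).
  apply: (socle_free_exp (p := p) (depth_socle_free dep)) => a /mpX aX.
  suff : ideal_add (ideal_add X (adj (gens ws) w)) B `<=` colon1 X u.
    by move=> /(_ a aX); rewrite colon1E mulrC.
  rewrite defB; apply: ideal_add_sub; last first.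
    apply: gens_sub => b bsb; rewrite colon1E mulrC.
    by apply: Xbs; rewrite mem_cat bsb orbT.
  apply: ideal_add_sub => [x Xx|]; first exact: idealM.
  apply: adj_sub; last by rewrite colon1E mulrC.
  apply: gens_sub => b wsb; rewrite colon1E mulrC.
  by apply: Xbs; rewrite mem_cat wsb.
have {}bw' : ideal_add (gens ws) B (w' - w).
  move: (w' - w) bw'; apply: gens_sub => x; rewrite mem_cat => /orP[] xs_x.
    by apply: ideal_addL; apply: gens_mem.
  by apply: ideal_addR; rewrite defB; apply: gens_mem.
have {}wsK : gens ws `<=` K /\ K w.
  by split=> [x wsx|]; apply: wsK; [apply: adjl|apply: adj_mem].
have Kw' : K w'.
  rewrite -(subrK w w'); apply: idealD; last by case: wsK.
  by apply: ideal_add_sub bw' => //; case: wsK.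
have [||| xs [szxs xsK regxs wsxs]] := IHws (adj X w').
- by case: wsK.
- move=> x /mpX; apply: ideal_add_sub; last exact: ideal_addR.
  apply: ideal_add_sub => [y Xy|].
    by do 2!apply: ideal_addL; apply: adjl.
  apply: adj_sub => [y wsy|]; first by apply: ideal_addL; apply: ideal_addR.
  rewrite -[w](subKr w'); apply: idealB.
    by do 2!apply: ideal_addL; apply: adj_mem.
  by move: (w' - w) bw'; apply: ideal_addS => //; apply: ideal_addR.
- by apply: depth_adj => //; apply: sKm.
have sub : ideal_add (gens ws) B `<=` ideal_add (adj (gens xs) w') B.
  apply: ideal_add_sub; last exact: ideal_addR.
  by move=> x /wsxs; apply: ideal_addS => //; apply: adjl.
exists (w' :: xs); split=> //=; first by rewrite szxs.
  exact: adj_sub.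
apply: adj_sub => [x wsx|]; first by apply: sub; apply: ideal_addL.
rewrite -[w](subKr w'); apply: idealB; last exact: sub.
by apply: ideal_addL; apply: adj_mem.
Qed.

End GenericScalars.

(** * Powers of an ideal generated by a regular sequence *)

(** The annihilator N of y in R/X satisfies N = x N, so it vanishes. *)
Lemma nzd_swapr X x y : m x -> nzd X x -> nzd (adj X x) y -> nzd X y.
Proof.
move=> mx Xx Xxy; suff : colon1 X y `<=` X by [].
apply: nakayama => u Xyu; have /adjP[v Xv] : adj X x u by apply: Xxy; apply: adjl.
exists (u - x * v) => //; exists (x * v); last by rewrite subrK.
apply: ideal_mul_mem => //; apply: Xx.
rewrite (_ : _ * _ = y * u - y * (u - x * v)); last by ring.
by apply: idealB => //; apply: idealM.
Qed.

Lemma regular_on_rot X x xs : gens (x :: xs) `<=` m ->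
  regular_on X (x :: xs) -> regular_on X (rcons xs x).
Proof.
elim: xs X => [|y xs IHxs] X //= xsm [Xx [Xxy reg]].
have mx : m x by apply: xsm; apply: adj_mem.
split; first exact: nzd_swapr Xxy.
apply: IHxs => /= [u|]; last by split; [apply: nzd_swap|rewrite adjC].
by move=> xsu; apply: xsm; rewrite adjC; apply: adjl.
Qed.

Lemma regular_on_rcons X x xs : regular_on X (rcons xs x) ->
  regular_on X xs /\ nzd (ideal_add X (gens xs)) x.
Proof.
elim: xs X => [|y xs IHxs] X /=; first by rewrite ideal_add0; case.
by move=> [Xy /IHxs[reg]]; rewrite ideal_add_adj.
Qed.

(** Modulo X one has J^(n+1) = x J^n + A^(n+1) for J = A + (x), and x can be cancelled
    from the first summand and, being regular modulo A^(n+1), from the second. *)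
Lemma power_colon1 X A x n : nzd (ideal_add X (ideal_exp A n.+1)) x ->
  colon1 (ideal_add X (ideal_exp (adj A x) n.+1)) x
    `<=` ideal_add X (ideal_exp (adj A x) n).
Proof.
move=> Xx u [y Xy [_ /adj_exp[a Aa [_ [v Av <-] <-]] eqxu]].
rewrite -(subrK v u); apply: idealD; last exact: ideal_addR.
have : ideal_add X (ideal_exp A n.+1) (u - v).
  apply: Xx; exists y => //; exists a => //.
  by rewrite mulrBr -eqxu; ring.
apply: ideal_addS => // b /exp_le Ab.
by apply: (@exp_sub _ A) => [c|]; [apply: adjl|apply: Ab].
Qed.

(** Reducing modulo the first element x of the sequence shows that an annihilator u
    of z is a multiple x v modulo the power, and power_colon1 then allows an
    induction on the exponent for v. The regularity of x modulo powers of the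
    remaining elements, required by power_colon1, comes from the induction on the
    length of the sequence, once x has been moved to its end. *)
Lemma nzd_power X xs z n : gens (rcons xs z) `<=` m -> regular_on X (rcons xs z) ->
  nzd (ideal_add X (ideal_exp (gens xs) n)) z.
Proof.
elim: xs X z n => [|x xs IHxs] X z n xsm /=.
  move=> [Xz _]; case: n => [u _|n]; first by apply: ideal_addR.
  rewrite (_ : ideal_exp _ _ = zero_ideal R) ?ideal_add0 //.
  by apply: ideal_ext => [|_ ->]; [apply: exp1_sub|apply: ideal0].
move=> [Xx reg]; set A := gens xs.
have xzm : gens (rcons xs z) `<=` m by move=> u xsu; apply: xsm; apply: adjl.
have xxm : gens (rcons xs x) `<=` m.
  rewrite gens_rcons; apply: adj_sub => [u xsu|].
    by apply: xzm; rewrite gens_rcons; apply: adjl.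
  by apply: xsm; apply: adj_mem.
have nzd_x k : nzd (ideal_add X (ideal_exp A k)) x.
  apply: IHxs => //; apply: regular_on_rot; first by rewrite /= -gens_rcons.
  by split=> //; have [] := regular_on_rcons reg.
elim: n => [u _|n IHn u Xzu]; first exact: ideal_addR.
have : ideal_add (adj X x) (ideal_exp A n.+1) u.
  apply: IHxs reg _ _ => //; move: Xzu; rewrite -ideal_add_adj.
  apply: ideal_addS => // v /adj_exp; apply: ideal_addS => //.
  by move=> _ [w _ <-]; exists w.
rewrite -ideal_add_adj => -[y Xy [_ [a Aa [_ [v _ <-] <-]]] equ].
have XJ : ideal_add X (ideal_exp (adj A x) n.+1) (y + a).
  apply: idealD; first exact: ideal_addL.
  by apply: ideal_addR; apply: exp_sub Aa; apply: adjl.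
have XJv : ideal_add X (ideal_exp (adj A x) n) v.
  apply: IHn; apply: power_colon1; first exact: nzd_x.
  rewrite colon1E (_ : _ * _ = z * u - z * (y + a)); last by rewrite -equ; ring.
  by apply: idealB => //; apply: idealM.
rewrite -equ addrA; apply: idealD => //.
have [b Xb [c Jc <-]] := XJv; rewrite mulrDr; apply: idealD.
  by apply: ideal_addL; apply: idealM.
by apply: ideal_addR; apply: exp_addS => //; apply: adj_mem.
Qed.
(** * Chains of ideals *)

(** A lower bound c for the length of B/A, which may be infinite. *)
Definition chain A B c := exists K : nat -> ideal R,
  (forall i, (i <= c)%N -> A `<=` K i /\ K i `<=` B) /\
  (forall i, (i < c)%N -> K i `<` K i.+1).

Lemma chain0 A B : A `<=` B -> chain A B 0.
Proof. by move=> sAB; exists (fun=> A); split=> // i _; split. Qed.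

Lemma chain1 A B : A `<` B -> chain A B 1.
Proof.
move=> ltAB; exists (fun i => if i is 0 then A else B).
by split=> -[|[|//]] // _; split=> //; case: ltAB.
Qed.

Lemma chainS A A' B B' c : A' `<=` A -> B `<=` B' -> chain A B c -> chain A' B' c.
Proof.
move=> sA sB [K [AKB ltK]]; exists K; split=> // i /AKB[AK KB].
by split; [apply: subset_trans AK|apply: subset_trans sB].
Qed.

Lemma chain_cat A B C a b : chain A B a -> chain B C b -> chain A C (a + b).
Proof.
move=> [K [AKB ltK]] [M [BMC ltM]].
have [AK0 _] := AKB 0%N isT; have [_ KaB] := AKB a (leqnn a).
have [BM0 M0C] := BMC 0%N isT; have [AKa _] := AKB a (leqnn a).
exists (fun i => if (i <= a)%N then K i else M (i - a)%N); split=> i lti.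
  case: leqP => [/AKB[AK KB]|ltai]; first split=> //.
    by apply: subset_trans KB (subset_trans BM0 M0C).
  have [|BM MC] := BMC (i - a)%N; first by lia.
  by split=> //; apply: subset_trans BM; apply: subset_trans AKa _.
case: (leqP i a) => [leia|ltai].
  case: (leqP i.+1 a) => [ltia|?]; first exact: ltK.
  have -> : i = a by lia.
  rewrite subSnn; have [sM nsM] : M 0%N `<` M 1%N by apply: ltM; lia.
  split=> [|sMK]; first by apply: subset_trans KaB _; apply: subset_trans sM.
  by apply: nsM; apply: subset_trans sMK _; apply: subset_trans BM0.
by rewrite leqNgt ltnS (ltnW ltai) /= subSn ?(ltnW ltai) //; apply: ltM; lia.
Qed.

(** Multiplication by x identifies R/(E : x) with (E + (x))/E. *)
Lemma chain_colon1 E C x c : chain (colon1 E x) C c ->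
  chain E (ideal_add E (ideal_scale x C)) c.
Proof.
move=> [K [EKC ltK]]; exists (fun i => ideal_add E (ideal_scale x (K i))); split=> i lti.
  split; first exact: ideal_addL.
  by apply: ideal_addS => // _ [a Ka <-]; exists a => //; case: (EKC i lti) => _; apply.
have [sK nsK] := ltK i lti; split.
  by apply: ideal_addS => // _ [a Ka <-]; exists a => //; apply: sK.
move=> sEK; apply: nsK => a Ka.
have [|y Ey [_ [b Kb <-] eqa]] := sEK (x * a).
  by apply: ideal_addR; exists a.
rewrite -(subrK b a); apply: idealD => //.
case: (EKC i (ltnW lti)) => + _; apply; rewrite colon1E.
by rewrite mulrBr -eqa addrK.
Qed.

(** * Lengths modulo powers of a regular sequence *)

(** With E = (X + J^(n+1)) : L, the length of R/E is the sum of the lengths of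
    R/(E : x) and R/(E + (x)). The first one concerns the exponent n, by power_colon1,
    and the second one the shorter sequence modulo x. This is Pascal's rule for the
    binomial coefficients. *)
Lemma regular_power_chain xs X (L : ideal R) c n :
    gens xs `<=` m -> regular_on X xs ->
    chain (colon (ideal_add X (gens xs)) L) (idealT R) c ->
  chain (colon (ideal_add X (ideal_exp (gens xs) n.+1)) L) (idealT R)
    (c * 'C(n + size xs, size xs)).
Proof.
elim: xs X n => [|x xs IHxs] X n xsm /=.
  move=> _; rewrite bin0 muln1; apply: chainS => // u Lu l /Lu.
  by apply: ideal_addS => //; apply: exp1_sub.
move=> [Xx reg] cL; set J := adj (gens xs) x.
have sxsm : gens xs `<=` m by move=> u xsu; apply: xsm; apply: adjl.
have mod_x k : chain (colon (ideal_add (adj X x) (ideal_exp (gens xs) k.+1)) L)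
    (idealT R) (c * 'C(k + size xs, size xs)).
  by apply: IHxs => //; rewrite -ideal_add_adj.
have nzd_x k : nzd (ideal_add X (ideal_exp (gens xs) k)) x.
  by apply: nzd_power; [rewrite gens_rcons|apply: regular_on_rot].
elim: n => [|n IHn]; first by rewrite exp1 add0n binn muln1.
set E := colon _ L.
rewrite addSn binS mulnDr; apply: (@chain_cat _ (adj E x)).
  apply: chain_colon1; apply: chainS IHn => // u Eu l Ll.
  by apply: power_colon1 => //; rewrite colon1E mulrCA; apply: Eu.
rewrite -addSnnS; apply: chainS (mod_x n.+1) => //.
apply: adj_sub => [u Eu l /Eu|l _]; last first.
  by apply: ideal_addL; apply: idealM; apply: adj_mem.
rewrite -ideal_add_adj; apply: ideal_addS => // v /adj_exp.
by apply: ideal_addS => // _ [w _ <-]; exists w.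
Qed.
(** * Reductions with few generators *)

Section GenericPoints.
Variable t : nat -> R.
Hypothesis t_unit : forall i j, i != j -> exists b, b * (t i - t j) = 1.

(** For t_js the list of the scalars with indices in js, this is the ideal of the
    point (t_js : 1) of projective space, written in the coordinates xs, z. *)
Definition lines z xs (js : seq nat) : ideal R :=
  gens [seq p.1 - t p.2 * z | p <- zip xs js].

(** The component of degree n of the ideal of the Rees algebra of J which is generated
    by A in degree 1. *)
Definition degree_part A J n : ideal R :=
  if n is n'.+1 then ideal_mul A (ideal_exp J n') else zero_ideal R.

Lemma degree_partS A A' J J' n : A `<=` A' -> J `<=` J' ->
  degree_part A J n `<=` degree_part A' J' n.
Proof. by case: n => [|n] sA sJ /=; [|apply: ideal_mulS] => //; apply: exp_sub. Qed.

Lemma degree_part_mem A J n x y : J x -> degree_part A J n y ->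
  degree_part A J n.+1 (x * y).
Proof.
case: n => [_ ->|n Jx]; first by rewrite mulr0; apply: ideal0.
suff : degree_part A J n.+1 `<=` colon1 (degree_part A J n.+2) x by apply.
apply: ideal_mul_sub => a v Aa Jv; rewrite colon1E mulrCA.
by apply: ideal_mul_mem => //; apply: exp_addS.
Qed.

Lemma adj_exp_degree_part A z n :
  ideal_exp (adj A z) n `<=` adj (degree_part A (adj A z) n) (z ^+ n).
Proof.
elim: n => [v _|n IHn].
  by rewrite expr0; apply: ideal_one; apply: adj_mem.
apply: ideal_mul_sub => _ v [a Aa [_ [s _ <-] <-]] Jv.
rewrite mulrDl; apply: idealD; first by apply: adjl; apply: ideal_mul_mem.
have /adjP[w Pw] := IHn v Jv; rewrite -mulrA mulrCA; apply: idealM.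
apply/adjP; exists w; rewrite exprS -mulrA -mulrBr.
by apply: degree_part_mem => //; apply: adj_mem.
Qed.

(** The family N is a homogeneous ideal of the Rees algebra of J, and the second
    hypothesis says that its zero set contains the grid of all points (t_js : 1) with
    indices at least a. A polynomial vanishing on such a grid is zero, whence the
    lower bound by the number of monomials of degree n.

    The proof cuts with the hyperplane l = x - t_a z, which contains the points whose
    first index is a: the quotient by l is treated by induction on the number of
    variables, and the kernel part N : l, in degree one less, still vanishes at the
    points whose first index exceeds a. *)
Lemma fiber_chain xs z a n (N : nat -> ideal R) (J := adj (gens xs) z) :
    (forall k u v, J u -> N k v -> N k.+1 (u * v)) ->
    (forall js k, size js = size xs -> all (leq a) js ->
       ~ ideal_add (N k) (degree_part (lines z xs js) J k) (z ^+ k)) ->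
  chain (N n) (ideal_add (N n) (ideal_exp J n)) 'C(n + size xs, size xs).
Proof.
have trivial_chain k ys b (M : nat -> ideal R) (J' := adj (gens ys) z) :
    (forall js i, size js = size ys -> all (leq b) js ->
       ~ ideal_add (M i) (degree_part (lines z ys js) J' i) (z ^+ i)) ->
    chain (M k) (ideal_add (M k) (ideal_exp J' k)) 1.
  move=> ptM; apply: chain1; split=> [|sM]; first exact: ideal_addL.
  apply: (ptM (nseq (size ys) b) k); rewrite ?size_nseq //.
    by rewrite all_nseq leqnn orbT.
  apply: ideal_addL; apply: sM; apply: ideal_addR; apply: exp_mem.
  exact: adj_mem.
rewrite {}/J; elim: xs a n N => [|x xs IHxs] a n N.
  by move=> gradN ptN; rewrite bin0; apply: trivial_chain ptN.
elim: n a N => [|n IHn] a N gradN ptN.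
  by rewrite add0n binn; apply: trivial_chain ptN.
set J := adj _ z in gradN ptN *; pose l := x - t a * z.
have Jz : J z by apply: adj_mem.
have Jx : J x by apply: adjl; apply: adj_mem.
have Jl : J l by apply: idealB => //; apply: idealM.
pose P k : ideal R := ideal_add (N k) (degree_part (adj (zero_ideal R) l) J k).
have sJ : adj (gens xs) z `<=` J.
  by apply: adj_sub => // u xsu; apply: adjl; apply: adjl.
have lN k : ideal_exp J k `<=` colon1 (P k.+1) l.
  move=> u Ju; apply: ideal_addR; apply: ideal_mul_mem => //; apply: adj_mem.
rewrite /= addSn binS; apply: (@chain_cat _ (P n.+1)).
  have -> : (n + (size xs).+1)%N = (n + size (x :: xs))%N by [].
  have := IHn a.+1 (fun k => colon1 (N k.+1) l); rewrite -/J => chainN.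
  apply: chainS (chain_colon1 (chainN _ _)) => //
    [|k u v Ju Nv|[|j js]//= k [szjs] /andP[ltaj ltajs]].
  - apply: ideal_add_sub; first exact: ideal_addL.
    move=> _ [u [v Nv [w Jw <-]] <-]; rewrite mulrDr.
    by apply: idealD; [apply: ideal_addL|apply: lN].
  - by rewrite colon1E mulrCA; apply: gradN.
  (* Modulo x - t_j z, the form l is (t_j - t_a) z, a unit multiple of z. *)
  have [c c1] : exists c, c * (t j - t a) = 1 by apply: t_unit; rewrite gtn_eqF.
  move=> ptk; apply: (ptN (j :: js) k.+1); rewrite /= ?szjs //.
    by rewrite (ltnW ltaj); apply: sub_all ltajs => i /ltnW.
  rewrite -[z ^+ _]mul1r -c1 -mulrA; apply: idealM.
  rewrite (_ : _ * _ = l * z ^+ k - (x - t j * z) * z ^+ k); last first.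
    by rewrite /l exprS; ring.
  apply: idealB.
    have [u Nu [v dv <-]] := ptk; rewrite mulrDr; apply: idealD.
      exact: ideal_addL.
    by apply: ideal_addR; apply: degree_part_mem.
  apply: ideal_addR; apply: ideal_mul_mem; last exact: exp_mem.
  exact: adj_mem.
rewrite -addSnnS; have := IHxs a n.+1 P => chainP.
apply: chainS (chainP _ _) => // [|k u v Ju [b Nb [c Pc <-]]|js k szjs leajs ptP].
- apply: ideal_add_sub; last first.
    by move=> u /(exp_sub sJ); apply: ideal_addR.
  apply: ideal_add_sub; first exact: ideal_addL.
  move=> u dlu; apply: ideal_addR; move: u dlu.
  apply: ideal_mul_sub => u v lu Jv; apply: exp_addS => //.
  by apply: (adj_sub _ Jl) lu => _ ->; apply: ideal0.
- rewrite mulrDr; apply: idealD; first by apply: ideal_addL; apply: gradN; auto.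
  by apply: ideal_addR; apply: degree_part_mem; auto.
apply: (ptN (a :: js) k); rewrite /= ?szjs ?leqnn //.
have [u [v Nv [w dw <-]] [y dy <-]] := ptP.
rewrite -addrA; exists v => //; exists (w + y) => //; apply: idealD.
  move: w dw; apply: degree_partS => //; apply: adj_sub => [_ ->|]; last exact: adj_mem.
  exact: ideal0.
by move: y dy; apply: degree_partS => //; apply: adjl.
Qed.

Lemma adj_lines z xs js : size js = size xs ->
  adj (gens xs) z = adj (lines z xs js) z.
Proof.
rewrite /lines; elim: xs js => [|x xs IHxs] [|j js] //= [szjs].
rewrite adjC (IHxs _ szjs) [RHS]adjC; set A := adj _ z.
have Az : A z by apply: adj_mem.
apply: ideal_ext; apply: adj_sub => [u|]; do ?exact: adjl.
  have : adj A (x - t j * z) (x - t j * z + t j * z).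
    by apply: idealD; [apply: adj_mem|apply: adjl; apply: idealM].
  by rewrite subrK.
by apply: idealB; [apply: adj_mem|apply: adjl; apply: idealM].
Qed.

(** The homogeneous ideal to consider is the kernel N of the map from the Rees algebra
    of J to the fibre ring of J on R/H, given by m J^k + H in degree k. Under
    the assumption on lengths, some point of the grid is not a zero of N, which means
    that a power z^(k+1) lies in A J^k + N for the ideal A generated by the linear
    forms through that point. By Nakayama J^(k+1) is then contained in A J^k + H. *)
Lemma drop_generator xs z (H : ideal R) (J := adj (gens xs) z) :
    J `<=` m -> H `<=` m ->
    ~ (forall n, chain (ideal_add (ideal_exp J n) H) (idealT R)
                   'C(n + size xs, (size xs).+1)) ->
  exists ys, [/\ size ys = size xs, gens ys `<=` J &
    exists r, forall n, ideal_exp J (n + r) `<=` ideal_add (ideal_exp (gens ys) n) H].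
Proof.
move=> sJm sHm short; pose N k := ideal_add (ideal_mul m (ideal_exp J k)) H.
have [js [k [szjs zk]]] : exists js k, size js = size xs /\
    ideal_add (N k) (degree_part (lines z xs js) J k) (z ^+ k).
  apply: contrapT => nopt; apply: short; elim=> [|n IHn].
    by rewrite bin_small //; apply: chain0.
  rewrite addSn binS addnC; apply: chain_cat IHn.
  apply: chainS (@fiber_chain xs z 0 n N _ _).
  - apply: ideal_addS => //; apply: ideal_mul_sub => u v Ju Jv.
    by apply: ideal_mul_mem => //; apply: sJm.
  - apply: ideal_add_sub => //; last exact: ideal_addL.
    apply: ideal_addS => //; exact: ideal_mulr.
  - move=> k u _ Ju [v Jv [h Hh <-]]; rewrite mulrDr; apply: idealD.
      apply: ideal_addL; move: v Jv.
      suff : ideal_mul m (ideal_exp J k) `<=` colon1 (ideal_mul m (ideal_exp J k.+1)) u.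
        by move=> sub v /sub.
      apply: ideal_mul_sub => v w mv Jw; rewrite colon1E mulrCA.
      by apply: ideal_mul_mem => //; apply: exp_addS.
    by apply: ideal_addR; apply: idealM.
  - by move=> js k szjs _ zk; apply: nopt; exists js, k.
case: k zk => [|k zk].
  rewrite expr0 => m1; case: local_proper; move: 1 m1.
  apply: ideal_add_sub; last by move=> _ ->; apply: ideal0.
  by apply: ideal_add_sub => //; apply: ideal_mull.
set A := lines z xs js in zk *.
have defJ : J = adj A z by apply: adj_lines.
have sAJ : A `<=` J by rewrite defJ; apply: adjl.
have step : ideal_exp J k.+1 `<=` ideal_add (ideal_mul A (ideal_exp J k)) H.
  apply: nakayama; rewrite {1}defJ => u /adj_exp_degree_part.
  rewrite -defJ; apply: adj_sub => [v Av|].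
    by do 2!apply: ideal_addL.
  have [_ [v mv [h Hh <-]] [w Aw <-]] := zk; rewrite addrC [v + h]addrC addrA.
  apply: idealD; last exact: ideal_addR.
  by apply: ideal_addL; apply: idealD; [apply: ideal_addL|apply: ideal_addR].
exists [seq p.1 - t p.2 * z | p <- zip xs js]; split=> //.
  by rewrite size_map size_zip szjs minnn.
exists k; elim=> [|n IHn]; first by move=> u _; apply: ideal_addL.
rewrite addSnnS; apply: exp_add_sub => x y Jx /step[v Av [h Hh <-]].
rewrite mulrDr; apply: idealD; last by apply: ideal_addR; apply: idealM.
suff : ideal_mul A (ideal_exp J k)
    `<=` colon1 (ideal_add (ideal_exp A n.+1) H) x by apply.
apply: ideal_mul_sub => a w Aa Jw; rewrite colon1E mulrCA.
suff : ideal_add (ideal_exp A n) H `<=` colon1 (ideal_add (ideal_exp A n.+1) H) a.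
  by apply; apply: IHn; apply: exp_mul.
apply: ideal_add_sub => b Ab; last by apply: ideal_addR; apply: idealM.
by apply: ideal_addL; apply: exp_addS.
Qed.

End GenericPoints.
End NoetherianLocal.

(** * Growth of Hilbert polynomials *)

Lemma poly_eventually_neg (Q : {poly rat}) d : (size Q <= d.+1)%N -> Q`_d < 0 ->
  exists N delta : rat, 0 < delta /\ forall x, N <= x -> Q.[x] <= - delta.
Proof.
elim: d Q => [|d IHd] Q szQ Qd.
  exists 0, (- Q`_0); rewrite oppr_gt0; split=> // x _.
  by rewrite (size1_polyC szQ) hornerC coefC eqxx opprK.
elim/poly_ind: Q szQ Qd => [|q c _]; first by rewrite coef0 ltxx.
rewrite coefD coefMX coefC /= addr0 size_MXaddC => szq qd.
have szq' : (size q <= d.+1)%N.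
  by case: ifP szq => [/andP[/eqP-> _]|_]; rewrite ?size_poly0.
have [N [delta [dpos qneg]]] := IHd q szq' qd.
exists (Num.max N (Num.max 0 (c / delta + 1))), delta; split=> // x.
rewrite !ge_max => /and3P[Nx x0]; rewrite -lerBrDr ler_pdivrMr // => cx.
rewrite !hornerE; have := ler_wpM2r x0 (qneg x Nx) => qx.
by move: cx; rewrite mulrBl mul1r => cx; lra.
Qed.

Lemma leq_expn_bin n d : (n.+1 ^ d <= 'C(n + d, d) * d`!)%N.
Proof.
rewrite bin_ffact; elim: d => [|d IHd]; first by rewrite expn0 ffactn0.
rewrite addnS ffactSS expnS leq_mul //.
by rewrite ltnS leq_addr.
Qed.

(** The polynomial d! P(x) - c (x - r)^d has a negative coefficient in degree d, so it
    is negative for large x, whereas the assumed lower bound together with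
    c (n + 1)^d <= c d! binomial(n + d, d) makes it nonnegative at n + 1 + r. *)
Lemma hilbert_bound (P : {poly rat}) d c r N :
    (size P <= d.+1)%N -> d`!%:R * P`_d < c%:R ->
  ~ forall n, (N <= n)%N -> (c * 'C(n + d, d))%:R <= P.[(n.+1 + r)%:R].
Proof.
move=> szP Pd bnd; pose X_r : {poly rat} := ('X - r%:R%:P) ^+ d.
have szX : size X_r = d.+1 by rewrite size_exp_XsubC.
have Xd : X_r`_d = 1.
  by have /monicP := monic_exp d (monicXsubC (r%:R : rat)); rewrite lead_coefE -/X_r szX.
have [||N0 [delta [dpos Qneg]]] :=
    @poly_eventually_neg (d`!%:R *: P - c%:R *: X_r) d.
- rewrite (leq_trans (size_polyD _ _)) // size_polyN geq_max.
  by rewrite !(leq_trans (size_scale_leq _ _)) ?szX.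
- by rewrite coefB !coefZ Xd mulr1 subr_lt0.
pose n := (N + Num.bound `|N0|)%N.
have leN0 : N0 <= (n.+1 + r)%:R.
  apply: le_trans (ler_norm _) _; apply: le_trans (ltW (archi_boundP (normr_ge0 _))) _.
  by rewrite ler_nat /n addSn leqW // -addnA addnCA leq_addr.
have := Qneg _ leN0; rewrite hornerD hornerN !hornerZ.
rewrite horner_exp hornerXsubC natrD addrK => leQ.
have := bnd n (leq_addr _ _); rewrite natrM natrD => leP.
have := leq_expn_bin n d; rewrite -(ler_nat rat) natrM natrX => leC.
have fpos : 0 < (d`!%:R : rat) by rewrite ltr0n fact_gt0.
have c0 : 0 <= (c%:R : rat) by [].
have := ler_wpM2l c0 leC; have := ler_wpM2l (ltW fpos) leP.
lra.
Qed.

(** * Passing to a quotient ring *)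

Section QuotientChains.
Variables (R : comPzRingType) (H : ideal R).
Implicit Types (A I K : ideal R).

Lemma is_ideal_comap (J : ideal (ring_quot H)) : is_ideal [set x | J (quot_map H x)].
Proof.
split=> [|x y Jx Jy|a x Jx] /=; first by rewrite raddf0; apply: ideal0.
  by rewrite raddfD; apply: idealD.
by rewrite rmorphM; apply: idealM.
Qed.

Definition comap (J : ideal (ring_quot H)) : ideal R := Ideal (is_ideal_comap J).

(** Ideals containing H are recovered from their images, so that strict inclusions
    survive in R/H. *)
Lemma quot_ideal_comap A : H `<=` A -> comap (quot_ideal H A) = A.
Proof.
move=> sHA; apply: ideal_ext => x; last first.
  by move=> Ax J; apply; exists x.
have idA : is_ideal [set u | exists2 y, A y & quot_map H y = u].
  split=> [|_ _ [y Ay <-] [z Az <-]|a _ [y Ay <-]].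
  - by exists 0; [apply: ideal0|rewrite raddf0].
  - by exists (y + z); [apply: idealD|rewrite raddfD].
  - by have [b <-] := quot_map_surj a; exists (b * y); [apply: idealM|rewrite rmorphM].
move=> qx; have [_ [y Ay <-]|y Ay /quot_map_eq/sHA Ayx] := qx (Ideal idA).
  by exists y.
by rewrite -(subKr y x); apply: idealB.
Qed.

Lemma quot_ideal_exp I n : ideal_exp (quot_ideal H I) n `<=` quot_ideal H (ideal_exp I n).
Proof.
elim: n => [|n IHn].
  move=> u _; have [x <-] := quot_map_surj u.
  by move=> J; apply; exists x.
apply: ideal_mul_sub => u v Iu /IHn Iv.
have /(_ u Iu) : quot_ideal H I `<=` colon1 (quot_ideal H (ideal_exp I n.+1)) v.
  move=> a; apply=> _ [x Ix <-]; rewrite colon1E mulrC.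
  have /(_ v Iv) : quot_ideal H (ideal_exp I n)
      `<=` colon1 (quot_ideal H (ideal_exp I n.+1)) (quot_map H x).
    move=> b; apply=> _ [y Iy <-]; rewrite colon1E -rmorphM.
    by move=> J; apply; exists (x * y) => //; apply: exp_addS.
  by [].
by rewrite colon1E mulrC.
Qed.

Lemma quot_chain A I n c : H `<=` A -> ideal_exp I n `<=` A -> chain A (idealT R) c ->
  chain_lengths [set K | ideal_exp (quot_ideal H I) n `<=` K] c.
Proof.
move=> sHA sIA [K [AK ltK]]; exists (fun i => quot_ideal H (K i)).
have sHK i : (i <= c)%N -> H `<=` K i.
  by move=> /AK[sAK _]; apply: subset_trans sAK.
split=> i lti.
  move=> u /quot_ideal_exp; apply=> _ [x Ix <-] J; apply; exists x => //.
  by case: (AK i lti) => sAK _; apply: sAK; apply: sIA.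
have [sK nsK] := ltK i lti; split=> [u|sQ].
  by apply=> _ [x Kx <-] J; apply; exists x => //; apply: sK.
apply: nsK => x Kx; rewrite -(quot_ideal_comap (sHK i (ltnW lti))).
by apply: sQ => J; apply; exists x.
Qed.

Lemma krull_dim_quot d' d : krull_dim (ring_quot H) d' -> krull_dim R d -> (d' <= d)%N.
Proof.
move=> [_ lub] [ub _]; apply: (lub d) => c [K [primeK ltK]]; apply: ub.
exists (fun i => comap (K i)); split=> i lti.
  have [K1 Kprime] := primeK i lti; split=> [|x y].
    by apply: contra_not K1; rewrite /ideal_set /= rmorph1.
  by rewrite /ideal_set /= rmorphM; apply: Kprime.
have [sK nsK] := ltK i lti; split=> [x|sQ]; first exact: sK.
by apply: nsK => u; have [x <-] := quot_map_surj u; apply: sQ.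
Qed.

End QuotientChains.

(** * Reductions, multiplicity and the core *)

(** Representatives of distinct residue classes. *)
Lemma infinite_residue_units (R : comPzRingType) (m : ideal R) :
    local_ring m -> infinite_set [set: ring_quot m] ->
  exists t : nat -> R, forall i j, i != j -> exists b, b * (t i - t j) = 1.
Proof.
move=> locR /infiniteP/card_leP[f].
pose g i : ring_quot m := \val (f (to_setT i)).
have g_inj : injective g.
  move=> i j /val_inj eqf.
  have /(congr1 val) : to_setT i = to_setT j by apply: 'inj_f eqf; rewrite inE.
  by [].
exists (fun i => repr (g i)) => i j neqij; apply: (local_unit locR).
have reprg k : quot_map m (repr (g k)) = g k by apply: reprK.
by move=> /quot_map_eq; rewrite !reprg => /g_inj /eqP; apply/negP.
Qed.

Lemma reduction_exp (R : comPzRingType) (I K : ideal R) : reduction K I ->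
  exists r, forall n, ideal_exp I (n + r) `<=` ideal_exp K n.
Proof.
move=> [sKI [r defI]]; exists r; elim=> [|n IHn]; first by [].
rewrite addSnnS; apply: exp_add_sub => x y Ix; rewrite defI => Iy.
have /(_ y Iy) : ideal_mul K (ideal_exp I r) `<=` colon1 (ideal_exp K n.+1) x.
  apply: ideal_mul_sub => a b Ka Ib; rewrite colon1E mulrCA.
  by apply: exp_addS => //; apply: IHn; apply: exp_mul.
by [].
Qed.

(** Allows reductions with fewer than d generators to be listed with exactly d. *)
Lemma gens_pad (R : comPzRingType) (xs : seq R) k : gens (xs ++ nseq k 0) = gens xs.
Proof.
apply: ideal_ext; apply: gens_sub => x.
  by rewrite mem_cat mem_nseq; case/orP => [/gens_mem//|/andP[_ /eqP->]]; apply: ideal0.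
by move=> xsx; apply: gens_mem; rewrite mem_cat xsx.
Qed.

Section Core.
Variables (R : comPzRingType) (m : ideal R).
Hypotheses (noethR : noetherian R) (locR : local_ring m).
Variable t : nat -> R.
Hypothesis t_unit : forall i j, i != j -> exists b, b * (t i - t j) = 1.
(* P is the Hilbert polynomial of I on R/H. *)
Variables (I H : ideal R) (P : {poly rat}) (d N : nat).
Hypothesis chain_bound : forall n c (A : ideal R), (N <= n)%N ->
  H `<=` A -> ideal_exp I n `<=` A -> chain A (idealT R) c -> c%:R <= P.[n%:R].
Hypothesis size_P : (size P <= d.+1)%N.
Hypothesis sHm : H `<=` m.

(** As long as more than d generators are left, one of them can be dropped: otherwise
    the lengths would grow like a polynomial of degree larger than that of P. *)
Lemma exists_reduction (K : ideal R) : K `<=` m ->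
    (exists r, forall n, ideal_exp I (n + r) `<=` ideal_add (ideal_exp K n) H) ->
  exists ws, [/\ size ws = d, gens ws `<=` K &
    exists r, forall n, ideal_exp I (n + r) `<=` ideal_add (ideal_exp (gens ws) n) H].
Proof.
pose reduces xs := exists r, forall n,
  ideal_exp I (n + r) `<=` ideal_add (ideal_exp (gens xs) n) H.
move=> sKm; have [xs defK] := noetherian_gens noethR K; rewrite {1}defK => redK.
have sxsK : gens xs `<=` K by rewrite defK.
have [s szxs] : exists s, size xs = s by exists (size xs).
elim: s xs szxs sxsK redK {defK} => [|s IHs] xs szxs xsK redxs.
all: have [led|ltd] := leqP (size xs) d; first by
  exists (xs ++ nseq (d - size xs) 0); rewrite size_cat size_nseq subnKC // gens_pad.
  by rewrite szxs in ltd.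
have [r {}redxs] := redxs.
case: xs szxs xsK redxs ltd => //= z xs [szxs] xsK redxs ltd.
have [|||ys [szys ysJ [r' redys]]] := @drop_generator _ m noethR locR t t_unit xs z H.
- exact: subset_trans xsK sKm.
- exact: sHm.
- move=> long; apply: (@hilbert_bound P (size xs).+1 1 r N).
  + by apply: leq_trans size_P _; apply: leq_trans ltd _.
  + by rewrite nth_default ?mulr0 ?ltr01 //; apply: leq_trans size_P ltd.
  move=> n leNn; apply: (chain_bound (A := ideal_add (ideal_exp (adj (gens xs) z) n.+1) H)).
  + by lia.
  + exact: ideal_addR.
  + exact: redxs.
  by rewrite mul1n addnS -addSn; apply: long.
apply: (IHs ys); first by rewrite szys.
  exact: subset_trans ysJ xsK.
exists (r' + r)%N => n; rewrite addnA => u /redxs[v Jv [h' Hh' <-]].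
have [w Aw [h Hh <-]] := redys n v Jv.
by rewrite -addrA; exists w => //; exists (h + h') => //; apply: idealD.
Qed.

(** The argument described at the top, with e any integer bounding the leading
    coefficient d! P_d. *)
Lemma mul_power_sub_reduction (L K : ideal R) (e a : nat) :
    (forall l h, L l -> H h -> l * h = 0) ->
    ideal_exp m a `<=` I -> I `<=` m -> depth_ge m d (zero_ideal R) ->
    d`!%:R * P`_d <= e%:R -> reduction K I ->
  ideal_mul L (ideal_exp I e) `<=` K.
Proof.
move=> LH0 maI sIm dep leP redK.
have sKI : K `<=` I by case: redK.
have sKm : K `<=` m by apply: subset_trans sKI sIm.
have [r0 expK] := reduction_exp redK.
have [|ws [szws wsK [r1 redws]]] := exists_reduction sKm.
  by exists r0 => n u /expK; apply: ideal_addL.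
have idHK : is_ideal ((H : set R) `&` (K : set R)).
  split=> [|x y [Hx Kx] [Hy Ky]|b x [Hx Kx]]; first by split; apply: ideal0.
    by split; apply: idealD.
  by split; apply: idealM.
pose B := Ideal idHK.
(* As (ws) lies in K, a power of K inside (ws) + H lies in (ws) + (H meet K). *)
have mB : ideal_exp m (a * r0.+1 * r1.+1) `<=`
    ideal_add (ideal_add (zero_ideal R) (gens ws)) B.
  move=> u mu; have Ku : ideal_exp K r1.+1 u.
    by apply: exp_exp mu => v /(exp_exp maI)/(expK 1%N); rewrite exp1.
  have /(redws 1%N) : ideal_exp I (1 + r1) u by apply: exp_sub Ku.
  rewrite exp1 => -[v wsv [h Hh equ]]; rewrite -equ; apply: idealD.
    by apply: ideal_addL; apply: ideal_addR.
  apply: ideal_addR; split=> //; rewrite -(addKr v h) equ.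
  by apply: idealD; [apply: idealN; apply: wsK|apply: exp1_sub Ku].
have sBK : B `<=` K by move=> ? [].
rewrite -szws in dep.
have [xs [szxs xsK regxs wsxs]] := exists_regular_on noethR t_unit sBK sKm wsK mB dep.
have redxs n : ideal_exp I (n + r1) `<=` ideal_add (ideal_exp (gens xs) n) H.
  move=> u /redws[v wsv [h Hh <-]]; apply: idealD; last exact: ideal_addR.
  suff : ideal_exp (gens ws) n `<=` ideal_add (ideal_exp (gens xs) n) H by apply.
  elim: n {u v wsv h Hh} => [|n IHn]; first exact: ideal_addL.
  apply: ideal_mul_sub => x y /wsxs[x' xsx [h [Hh _] <-]] /IHn[y' xsy [h' Hh' <-]].
  rewrite mulrDr; apply: idealD; last by apply: ideal_addR; apply: idealM.
  rewrite mulrDl; apply: idealD; last by apply: ideal_addR; apply: idealMr.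
  by apply: ideal_addL; apply: exp_addS.
pose J := ideal_add (zero_ideal R) (gens xs).
have sJK : J `<=` K by apply: ideal_add_sub => // _ ->; apply: ideal0.
suff sIe : ideal_exp I e `<=` colon J L.
  by apply: ideal_mul_sub => l y Ll /sIe/(_ l Ll)/sJK.
apply: contrapT => nsIe.
(* Indexed so that F increases from (J : L) + I^e to the unit ideal. *)
pose F i := ideal_add (colon J L) (ideal_exp I (e - i)).
have chainF : chain (colon J L) (idealT R) e.+1.
  rewrite -add1n; apply: (@chain_cat _ _ (F 0%N)).
    apply: chain1; split=> [|sF]; first exact: ideal_addL.
    by apply: nsIe => x Ix; apply: sF; rewrite /F subn0; apply: ideal_addR.
  exists F; split=> i lti.
    split=> //; apply: ideal_addS => //; rewrite subn0.
    by apply: exp_le; rewrite leq_subr.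
  split=> [|sF].
    by apply: ideal_addS => //; apply: exp_le; rewrite leq_sub2l.
  apply: nsIe; apply: subset_trans (exp_le _) (_ : ideal_exp I (e - i.+1) `<=` _).
    by rewrite leq_subr.
  apply: (nakayama noethR locR) => u Iu.
  have /sF : F i.+1 u by apply: ideal_addR.
  rewrite /F subnS -(prednK (n := e - i)) ?subn_gt0 //=.
  by apply: ideal_addS => //; apply: ideal_mulS.
have bigchain n := @regular_power_chain _ m noethR locR xs (zero_ideal R) L e.+1 n
  (subset_trans xsK sKm) regxs chainF.
apply: (@hilbert_bound P d e.+1 r1 N) => // [|n leNn].
  by apply: le_lt_trans leP _; rewrite ltr_nat.
have := bigchain n; rewrite szxs szws; apply: chain_bound.
- by lia.
- move=> h Hh l Ll; rewrite LH0 //; exact: ideal0.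
move=> u /redxs[v xsv [h Hh <-]] l Ll; rewrite mulrDr (LH0 l h) // addr0.
by apply: ideal_addR; apply: idealM.
Qed.

End Core.

Theorem proposition6p1 (R : comNzRingType) (m I L H : ideal R) (e : nat)
  (R_CM : local_cohen_macaulay m)
  (residue_field_infinite : infinite_set [set: ring_quot m])
  (I_primary : primary_to m I)
  (LH0 : ideal_mul L H = [set 0] :> set R)
  (e_def : multiplicity (quot_ideal H I) e) :
  ideal_mul L (ideal_exp I e) `<=` core I.
Proof.
have [noethR locR [d dimR depthR]] := R_CM.
have [_ radI] := I_primary.
have [d' [P [dimRH [N lenP] szP eP]]] := e_def.
have LH l h : L l -> H h -> l * h = 0.
  by move=> Ll Hh; have := ideal_mul_mem Ll Hh; rewrite LH0.
(* If H is the unit ideal, then L = 0. *)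
have [H1|nH1] := pselect (H 1).
  move=> x LIx K _; apply: (ideal_mul_sub _ LIx) => l y Ll _.
  by rewrite -[l]mulr1 (LH l 1) // mul0r; apply: ideal0.
have sHm := proper_sub_max locR nH1.
have led : (d' <= d)%N := krull_dim_quot dimRH dimR.
have [t t_unit] := infinite_residue_units locR residue_field_infinite.
have bound n c (A : ideal R) : (N <= n)%N -> H `<=` A -> ideal_exp I n `<=` A ->
    chain A (idealT R) c -> c%:R <= P.[n%:R].
  move=> leNn sHA sIA chainA; have [l [ub _] ->] := lenP n leNn.
  by rewrite ler_nat; apply: ub; apply: quot_chain chainA.
(* A supremum of natural numbers is attained when it is positive. *)
have dep : depth_ge m d (zero_ideal R).
  case: d dimR depthR led => // d dimR [ub lub] led.
  apply: contrapT => ndep; have : (d.+1 <= d)%N; last by rewrite ltnn.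
  apply: lub => k [s [regs sm] szs].
  have lekd : (k <= d.+1)%N by apply: ub; exists s.
  change (k <= d)%N; rewrite -ltnS ltn_neqAle lekd andbT.
  apply/eqP => kd; apply: ndep; rewrite -kd -szs.
  exact: regular_seq_depth regs sm.
have [xs defm] := noetherian_gens noethR m.
have [|a maI] := @gens_nilpotent _ xs I.
  by move=> x /gens_mem; rewrite -defm -radI.
move=> x LIx K redK; move: x LIx.
apply: (mul_power_sub_reduction noethR locR t_unit bound (d := d) _ sHm LH (a := a)) redK.
- by apply: leq_trans szP _.
- by rewrite defm.
- by move=> x Ix; rewrite -radI; exists 1%N.
- exact: dep.
(* If dim R/H < d, the coefficient of degree d of P vanishes. *)
have [->|neqd] := eqVneq d d'; first by rewrite -eP.
by rewrite nth_default ?mulr0 // (leq_trans szP) // ltn_neqAle eq_sym neqd.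
Qed.
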